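(* Let $\mathcal{A}$ be a Fréchet algebra (associative) with unit $Id$, let $P:\mathbb{R}\to\mathcal{A}$ be a smooth path, and let $L(0)\in\mathcal{A}$ be a fixed element. Let $P_q(t)=qP(qt)$, regarded as a smooth path with values in $\mathcal{A}[[q]]_{>0}$. Then the solutions $t\mapsto L_q(t)\in\mathcal{A}[[q]]$ of the equation $$\partial_t L_q(t)=[P_q(t),L_q(t)],\qquad L_q(0)=L(0),$$ are such that $$L_q(t)=\exp(P_q)(t)\cdot L(0)\cdot\left(\exp(P_q)(t)\right)^{-1},$$ where $\exp$ is the group exponential (taking smooth paths in $\mathcal{A}[[q]]_{>0}$ to paths in the group $Id+\mathcal{A}[[q]]_{>0}$).
   Context: $\mathcal{A}[[q]]$ is the algebra of formal power series $\sum_{k\ge 0}q^k a_k$ with $a_k\in\mathcal{A}$, where $q$ is a formal parameter commuting with $\mathcal{A}$. It carries the product topology of $\mathcal{A}^{\mathbb{N}}$, and derivatives and integrals in $t$ are taken coefficientwise. The ideal $\mathcal{A}[[q]]_{>0}$ consists of the series whose $q$-valuation is $>0$ (zero constant term). The bracket is the commutator $[a,b]=ab-ba$. $\mathcal{A}$ is viewed inside $\mathcal{A}[[q]]$ as the constant series. The path $P_q$ comes from the time scaling $t\mapsto qt$. As an element of $\mathcal{A}[[q]]$, $qP(qt)$ is the series $\sum_{k\ge 0}q^{k+1}\frac{t^k}{k!}P^{(k)}(0)$. For a smooth path $v:\mathbb{R}\to\mathcal{A}[[q]]_{>0}$, the group exponential $\exp(v)$ is the path in $Id+\mathcal{A}[[q]]_{>0}$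 given by $$\exp(v)(t)=\sum_{i=0}^{\infty}a_i,\qquad a_0=Id,\qquad a_i=\int_0^t\int_0^{s_1}\cdots\int_0^{s_{i-1}}v(s_1)v(s_2)\cdots v(s_i)\,ds_i\cdots ds_1\quad(i\ge 1).$$ For $t\ge 0$, $a_i$ is the integral over $t\ge s_1\ge\dots\ge s_i\ge 0$ of the ordered product. The sum is well defined in $\mathcal{A}[[q]]$ because $a_i$ has $q$-valuation at least $i$. *)

(* Defs.v *)
From HB Require Import structures.
From mathcomp Require Import all_boot all_order all_algebra.
From mathcomp Require Import all_classical all_reals all_analysis.

Set Implicit Arguments.
Unset Strict Implicit.
Unset Printing Implicit Defensive.

Import Order.TTheory GRing.Theory Num.Theory.
Import numFieldNormedType.Exports.

Local Open Scope classical_set_scope.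
Local Open Scope ring_scope.

(** A Fréchet space is a locally convex topological vector space ([Tvs]) that is
complete and metrizable (a uniform space is metrizable iff it is Hausdorff and
its uniformity has a countable base).  The uniformity of a [Tvs] is only known
to induce the topology; [frechet_add_unif_continuous] forces it to be the
canonical translation-invariant one, so that [cauchy] has its usual meaning for
topological vector spaces.  This and completeness are restated because
hierarchy-builder accepts no join of [Tvs] with [UniformZmodule] or [Complete].
The scalars are real; a complex Fréchet algebra is in particular a real one. *)

HB.mixin Record Tvs_isFrechet (R : realType) V & Tvs R V := {
  frechet_add_unif_continuous : unif_continuous (fun x : V * V => x.1 + x.2) ;
  frechet_hausdorff : hausdorff_space V ;
  frechet_countable_uniformity : countable_uniformity V ;
  frechet_complete : forall F : set_system V,
    ProperFilter F -> cauchy F -> exists l : V, F --> l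
}.

#[short(type="frechetType")]
HB.structure Definition Frechet (R : realType) :=
  {V of Tvs R V & Tvs_isFrechet R V}.

HB.mixin Record Frechet_isFrechetAlgebra (R : realType) A
    & Frechet R A & GRing.Algebra R A := {
  frechet_mul_continuous : continuous (fun x : A * A => x.1 * x.2)
}.

#[short(type="frechetAlgType")]
HB.structure Definition FrechetAlgebra (R : realType) :=
  {A of Frechet R A & GRing.Algebra R A & Frechet_isFrechetAlgebra R A}.

(** The library derivative [derive1] is restricted to normed modules; these are the
same definitions over a Fréchet space.  Likewise [limit] replaces [lim], which
requires a pointed type. *)

Definition limit (V : NbhsZmodule.type) (F : set_system V) : V :=
  xget 0 [set l | F --> l].

Section PathDerivative.
Context (R : realType) (V : frechetType R).
Implicit Types (f : R -> V) (t : R).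

Definition path_derivable f t :=
  exists l : V, h^-1 *: (f (h + t) - f t) @[h --> (0 : R)^'] --> l.

Definition path_derive f t : V :=
  limit (h^-1 *: (f (h + t) - f t) @[h --> (0 : R)^']).

Definition path_deriven n f : R -> V := iter n path_derive f.

Definition smooth_path f :=
  forall (n : nat) t, path_derivable (path_deriven n f) t.

End PathDerivative.

Lemma path_derive_eq (R : realType) (V : frechetType R) (f : R -> V) t l :
  h^-1 *: (f (h + t) - f t) @[h --> (0 : R)^'] --> l -> path_derive f t = l.
Proof.
move=> fl; rewrite /path_derive /limit; case: xgetP => [m _ fm|].
  exact: (cvg_unique (@frechet_hausdorff R V) fm fl).
by move=> /(_ l); contradiction.
Qed.

Lemma path_derive_scale (R : realType) (V : frechetType R) (g : R -> R) (a : V)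
    (t l : R) : is_derive (t : R) (1 : R) g l ->
  h^-1 *: (g (h + t) *: a - g t *: a) @[h --> (0 : R)^'] --> l *: a.
Proof.
move=> [dg dgl].
have c : h^-1 *: (g (h + t) - g t) @[h --> (0 : R)^'] --> l.
  rewrite -dgl; move: dg; rewrite /derivable /derive /=.
  by under eq_fun do rewrite [_%:A]mulr1.
have ca : {for (l : R^o), continuous (fun k : R^o => k *: a)}.
  rewrite /continuous_at.
  apply: (@cvg_comp R^o (R^o * V)%type V (fun k => (k, a))
    (fun z => z.1 *: z.2) (nbhs (l : R^o)) (nbhs ((l : R^o), a))); last first.
    exact: (@scale_continuous R V (l, a)).
  apply: (@cvg_pair R^o R^o V _ (nbhs (l : R^o)) (nbhs a)).
    exact: cvg_id.
  exact: cvg_cst.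
rewrite (_ : (fun h => _) = (fun h : R => (h^-1 *: (g (h + t) - g t)) *: a)).
  exact: continuous_cvg ca c.
by apply/funext => h; rewrite -scalerBl scalerA.
Qed.

Lemma is_derive_monomial (R : realType) (c t : R) m :
  is_derive (t : R) (1 : R) (fun t => c * t ^+ m) (c * m%:R * t ^+ m.-1).
Proof.
have h : is_derive (t : R) (1 : R) (fun t => t ^+ m) (m%:R * t ^+ m.-1).
  have := @exp_derive R m t 1; rewrite [_ *: 1]mulr1 => h.
  by have h' := @exprn_derivable R m t 1; split.
have := @is_deriveZ R R R _ c t 1 _ h.
by rewrite [_ *: _]mulrA.
Qed.

Lemma smooth_monomial (R : realType) (V : frechetType R) k (b : R) (a : V) :
  smooth_path (fun t : R => (t ^+ k / b) *: a).
Proof.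
have H (n : nat) : exists (c : R) m,
    path_deriven n (fun t : R => (t ^+ k / b) *: a) =
    (fun t => (c * t ^+ m) *: a).
  elim: n => [|n [c [m e]]].
    by exists b^-1, k; apply/funext => t; rewrite mulrC.
  exists (c * m%:R), m.-1; apply/funext => t; rewrite /path_deriven iterS.
  rewrite -/(path_deriven _ _) e.
  by apply: path_derive_eq; exact: path_derive_scale (is_derive_monomial c t m).
move=> n t; have [c [m ->]] := H n.
by eexists; exact: path_derive_scale (is_derive_monomial c t m).
Qed.

Section RiemannIntegral.
Context (R : realType) (V : frechetType R).
Implicit Types (f : R -> V) (a b d : R).

(** A tagged partition of [a, b] is a pair [(s, x)]: the division points after
[a], and one tag in each of the intervals that they cut out. *)
Definition tagged_partition a b d : set (seq R * seq R) :=
  [set p | [/\ itv_partition a b p.1, size p.2 = size p.1 &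
    forall i, (i < size p.1)%N ->
      nth 0 (a :: p.1) i <= nth 0 p.2 i <= nth 0 p.1 i /\
      nth 0 p.1 i - nth 0 (a :: p.1) i < d]].

Definition riemann_sum f a (p : seq R * seq R) : V :=
  \sum_(i < size p.1)
    (nth 0 p.1 i - nth 0 (a :: p.1) i) *: f (nth 0 p.2 i).

Definition riemann_filter a b : set_system (seq R * seq R) :=
  filter_from [set d : R | 0 < d] (tagged_partition a b).

(** Oriented: the endpoints may come in either order. *)
Definition path_integral f a b : V :=
  if a <= b then limit (riemann_sum f a @ riemann_filter a b)
  else - limit (riemann_sum f b @ riemann_filter b a).

End RiemannIntegral.

Definition fps (A : Type) := nat -> A.

Section FormalPowerSeries.
Context (R : realType) (A : frechetAlgType R).
Implicit Types a b c : fps A.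

HB.instance Definition _ := GRing.Zmodule.copy (fps A) (nat -> A).

Definition fps_const (x : A) : fps A := fun n => if n is 0%N then x else 0.

Definition fps_mul a b : fps A :=
  fun n => \sum_(j < n.+1) a j * b (n - j)%N.

Let coefD a b n : (a + b) n = a n + b n. Proof. by []. Qed.

Fact fps_mulA : associative fps_mul.
Proof.
move=> a b c; apply/funext => n; rewrite /fps_mul.
pose F i j := a i * (b j * c (n - i - j)%N).
transitivity (\sum_(i < n.+1) \sum_(j < n.+1 | (i + j <= n)%N) F i j).
  apply: eq_bigr => i _; rewrite big_distrr /=.
  have lein : (n - i < n.+1)%N by rewrite ltnS leq_subr.
  rewrite (big_ord_widen n.+1 (F i)) //; apply: eq_bigl => j.
  by rewrite ltnS leq_subRL // -ltnS.
transitivity (\sum_(k < n.+1) \sum_(i < n.+1 | (i <= k)%N) F i (k - i)%N).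
  rewrite [RHS](exchange_big_dep predT) //=; apply: eq_bigr => i _.
  rewrite -[LHS](big_mkord (fun j => i + j <= n)%N (F i)).
  rewrite -[RHS](big_mkord (fun k => i <= k)%N (fun k => F i (k - i)%N)).
  rewrite [RHS](@big_cat_nat _ _ _ i) //=; last exact: ltnW.
  rewrite [X in _ = X + _]big_nat_cond [X in _ = X + _]big_pred0 ?add0r;
    last by move=> k /=; case: (ltnP k i).
  rewrite -[X in _ = \sum_(X <= _ < _ | _) _]add0n big_addn.
  rewrite (@big_cat_nat _ _ _ (n.+1 - i)%N) //=; last exact: leq_subr.
  rewrite [X in _ + X]big_nat_cond [X in _ + X]big_pred0 ?addr0; last first.
    move=> j; apply/negP => /andP[/andP[+ _] h].
    by rewrite leqNgt ltn_subRL ltnS h.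
  rewrite big_nat_cond [RHS]big_nat_cond.
  apply: eq_big => [j|j _]; last by rewrite addnK.
  by rewrite leq_addl andbT /= ltn_subRL ltnS; case: leqP.
apply: eq_bigr => k _; rewrite big_distrl /=.
rewrite (big_ord_widen n.+1 (fun i => a i * b (k - i)%N * c (n - k)%N)) //.
apply: eq_big => [i|i ik]; first by rewrite ltnS.
by rewrite /F -mulrA -subnDA subnKC.
Qed.

Fact fps_mul1 : left_id (fps_const 1) fps_mul.
Proof.
move=> a; apply/funext => n; rewrite /fps_mul big_ord_recl /= mul1r subn0.
by rewrite big1 ?addr0 // => i _; rewrite mul0r.
Qed.

Fact fps_mulr1 : right_id (fps_const 1) fps_mul.
Proof.
move=> a; apply/funext => n; rewrite /fps_mul big_ord_recr /= subnn mulr1.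
rewrite big1 ?add0r // => i _.
by have := ltn_ord i; rewrite -subn_gt0; case: (n - i)%N => // m _; rewrite mulr0.
Qed.

Fact fps_mulDl : left_distributive fps_mul +%R.
Proof.
move=> a b c; apply/funext => n; rewrite coefD /fps_mul -big_split /=.
by apply: eq_bigr => i _; rewrite coefD mulrDl.
Qed.

Fact fps_mulDr : right_distributive fps_mul +%R.
Proof.
move=> a b c; apply/funext => n; rewrite coefD /fps_mul -big_split /=.
by apply: eq_bigr => i _; rewrite coefD mulrDr.
Qed.

Fact fps_oner_neq0 : fps_const 1 != 0.
Proof.
by apply/eqP => /(congr1 (fun a : fps A => a 0%N)) /= /eqP; rewrite oner_eq0.
Qed.

HB.instance Definition _ := GRing.Zmodule_isNzRing.Build (fps A)
  fps_mulA fps_mul1 fps_mulr1 fps_mulDl fps_mulDr fps_oner_neq0.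

Definition fps_unit : pred (fps A) :=
  fun a => `[< exists b, b * a = 1 /\ a * b = 1 >].

Definition fps_inv a : fps A := xget a [set b | b * a = 1 /\ a * b = 1].

Fact fps_invP a : a \in fps_unit -> fps_inv a * a = 1 /\ a * fps_inv a = 1.
Proof.
by move=> /asboolP h; exact: (xgetPex a h).
Qed.

Fact fps_mulVr : {in fps_unit, left_inverse 1 fps_inv *%R}.
Proof. by move=> a /fps_invP[]. Qed.

Fact fps_divrr : {in fps_unit, right_inverse 1 fps_inv *%R}.
Proof. by move=> a /fps_invP[]. Qed.

Fact fps_unitrP a b : b * a = 1 /\ a * b = 1 -> fps_unit a.
Proof. by move=> ab; apply/asboolP; exists b. Qed.

Fact fps_inv_out : {in [predC fps_unit], fps_inv =1 id}.
Proof.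
move=> a /asboolPn na; rewrite /fps_inv; case: xgetP => // b _ ab.
by case: na; exists b.
Qed.

HB.instance Definition _ := GRing.NzRing_hasMulInverse.Build (fps A)
  fps_mulVr fps_divrr fps_unitrP fps_inv_out.

HB.instance Definition _ :=
  Topological.copy (fps A) (prod_topology (fun _ : nat => A)).

Definition fps_gt0 : set (fps A) := [set a | a 0%N = 0].

Definition fps_group : set (fps A) := [set 1 + u | u in fps_gt0].

Lemma fps_val_exp (u : fps A) i n :
  fps_gt0 u -> (n < i)%N -> (u ^+ i) n = 0.
Proof.
move=> u0; elim: i n => // i IH n ni; rewrite exprS.
rewrite [LHS](_ : _ = \sum_(j < n.+1) u j * (u ^+ i) (n - j)%N) //.
rewrite big1 // => -[[|j] /= jn] _; first by rewrite u0 mul0r.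
rewrite IH ?mulr0 //; case: n ni jn => // n ni _.
by rewrite subSS (leq_ltn_trans (leq_subr _ _)).
Qed.

Lemma fps_group_unit (a : fps A) :
  fps_group a -> a \is a GRing.unit.
Proof.
move=> [u u0 <-]; pose w := - u.
have w0 : fps_gt0 w by rewrite /fps_gt0 /= -[RHS]oppr0 -[in RHS]u0.
have -> : 1 + u = 1 - w by rewrite opprK.
have sumE (f : nat -> fps A) m k : (\sum_(i < m) f i) k = \sum_(i < m) f i k.
  by elim: m => [|m IH]; rewrite ?big_ord0 // !big_ord_recr /= -IH.
pose g n : fps A := \sum_(i < n.+1) w ^+ i.
pose b : fps A := fun n => g n n.
have bE n m : (m <= n)%N -> b m = g n m.
  move=> mn; rewrite /b /g !sumE (big_ord_widen n.+1 (fun i => (w ^+ i) m)) //.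
  rewrite [RHS](bigID (fun i : 'I_n.+1 => (i < m.+1)%N)) /=.
  rewrite [X in _ = _ + X]big1 ?addr0 // => i.
  by rewrite -leqNgt; exact: fps_val_exp.
have one n : (1 - w ^+ n.+1) n = (1 : fps A) n.
  by rewrite [LHS](_ : _ = (1 : fps A) n - (w ^+ n.+1) n) // fps_val_exp ?subr0.
have gr n : (1 - w) * g n = 1 - w ^+ n.+1.
  by rewrite -[LHS]opprK -mulNr opprB -subrX1 opprB.
have gc n : g n * (1 - w) = (1 - w) * g n.
  rewrite mulrBr mulrBl mulr1 mul1r; congr (_ - _).
  by apply/esym/commr_sum => i _; exact: commrX.
apply/asboolP; exists b; split; apply/funext => n.
  rewrite -[RHS]one -gr -gc; apply: eq_bigr => j _.
  by rewrite (bE n) // -ltnS.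
rewrite -[RHS]one -gr; apply: eq_bigr => j _.
by rewrite (bE n) // leq_subr.
Qed.

End FormalPowerSeries.

Section FormalPowerSeriesPaths.
Context (R : realType) (A : frechetAlgType R).
Implicit Types (v L : R -> fps A) (t : R).

Definition fps_path_derivable v t :=
  forall k, path_derivable (fun s => v s k) t.

Definition fps_path_derive v t : fps A :=
  fun k => path_derive (fun s => v s k) t.

Definition fps_smooth_path v := forall k, smooth_path (fun s => v s k).

Definition fps_path_integral v (a b : R) : fps A :=
  fun k => path_integral (fun s => v s k) a b.

(** [iterated_integral v i w t] is the integral of
[w * v s_1 * ... * v s_i] over [s_i] from 0 to [s_(i-1)], ..., [s_2] from 0 to
[s_1], [s_1] from 0 to [t]. *)
Fixpoint iterated_integral v (i : nat) (w : fps A) t : fps A :=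
  if i is j.+1 then
    fps_path_integral (fun s => iterated_integral v j (w * v s) s) 0 t
  else w.

(** The sum is a limit in the product topology of [A[[q]]]. *)
Definition group_exp v t : fps A :=
  limit (series (fun i => iterated_integral v i 1 t) @ \oo).

(** The series [q P(q t)], with [P(q t)] expanded at [0]. *)
Definition scaled_path (P : R -> A) t : fps A :=
  fun n => if n is k.+1 then (t ^+ k / k`!%:R) *: path_deriven k P 0 else 0.

Lemma scaled_path_gt0 (P : R -> A) t : fps_gt0 (scaled_path P t).
Proof. by []. Qed.

Lemma scaled_path_smooth (P : R -> A) : fps_smooth_path (scaled_path P).
Proof.
case=> [|k]; last exact: smooth_monomial.
rewrite (_ : (fun s => _) = (fun s : R => (s ^+ 0 / 0) *: (0 : A))).
  exact: smooth_monomial.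
by apply/funext => s; rewrite scaler0.
Qed.

End FormalPowerSeriesPaths.

(* Main.v *)
Require Import Defs.
From mathcomp Require Import all_boot all_order all_algebra.
From mathcomp Require Import all_classical all_reals all_analysis.
From mathcomp Require Import ring lra.
Import Order.TTheory GRing.Theory Num.Theory.
Import numFieldNormedType.Exports.
Local Open Scope classical_set_scope.
Local Open Scope ring_scope.
Set Implicit Arguments.
Unset Strict Implicit.

(** Write v for the path [scaled_path P] and U for its group exponential.  Every
coefficient of v is a monomial in t, so every iterated integral of v is, in
each degree, a polynomial in t with coefficients in A.  Integration is then the
fundamental theorem of calculus for polynomials, and no integral of a general
continuous A-valued function ever occurs.

Let E_i be the i-th iterated integral started from 1.  A constant left factor
passes through the integrals, so the nested definition of [iterated_integral]
is the recursion in which E_(i+1) is the integral from 0 of v * E_i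
([iterated_integralE]).  As v has positive valuation, E_i has valuation at least
i ([iterated_integral_valuation]).  Hence in each degree the series of the E_i
is a finite sum ([group_exp_coef]), its constant term is 1, and summing the
recursion gives U' = v U with U(0) = 1 ([has_derive_group_exp]).

Given a solution L of L' = [v, L], the path M = L U - U L(0) satisfies
M' = (v L - L v) U + L v U - v U L(0) = v M and M(0) = 0.  In degree k the
series v M only involves the coefficients of M in degrees less than k, so by
induction on k the k-th coefficient of M has derivative zero, and is constantly 0
([fps_linear_ode_eq0]).  Thus L U = U L(0), which is the claim; comparing L U
with U L(0), rather than L with its conjugate, avoids differentiating the inverse
of U.

The one analytic ingredient is that a path with zero derivative in a Fréchet
space is constant ([has_derive0_eq]).  There is no norm with which to copy the
mean value inequality, but local convexity does the work of a norm: difference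
quotients over short intervals lie in a convex neighbourhood of 0, and convexity
carries this over to long intervals. *)

(** * Paths with zero derivative *)

(** Induction along an interval: the supremum of the points that Q reaches from
a is reached, by the local property to its left, and could be passed, by the
local property to its right, if it were not b. *)
Lemma local_to_global_additive (R : realType) (Q : R -> R -> Prop) :
  (forall a b c, a <= b -> b <= c -> Q a b -> Q b c -> Q a c) ->
  (forall s, exists2 d, 0 < d &
     forall a b, s - d < a -> a <= s -> s <= b -> b < s + d -> Q a b) ->
  forall a b, a <= b -> Q a b.
Proof.
move=> Qadd Qloc a b ab.
have Qrefl s : Q s s.
  by have [d d0] := Qloc s; apply=> //; rewrite ?ltrBlDr ltrDl.
pose E := [set x | [/\ a <= x, x <= b & Q a x]].
have Ea : E a by split.
have Esup : has_sup E by split; [exists a | exists b => x []].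
pose c := sup E.
have ac : a <= c by exact: (ub_le_sup (proj2 Esup)).
have cb : c <= b by apply: ge_sup; [exists a | move=> x []].
have [d d0 Qc] := Qloc c.
have Qac : Q a c.
  have [x [ax xb Qax] cx] := sup_adherent d0 Esup.
  have xc : x <= c by exact: (ub_le_sup (proj2 Esup)).
  by apply: Qadd Qax (Qc _ _ _ _ _ _) => //; rewrite ltrDl.
have [bc|cltb] := leP b c; first by rewrite (le_anti (introT andP (conj bc cb))).
pose y := Num.min b (c + d / 2).
have cy : c < y by rewrite lt_min cltb ltrDl divr_gt0.
have Ey : E y.
  split; first exact: le_trans (ltW cy).
    by rewrite ge_min lexx.
  apply: Qadd Qac (Qc _ _ _ _ _ _) => //; [exact: ltW| |exact: ltW|].
    by rewrite ltrBlDr ltrDl.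
  by rewrite gt_min; apply/orP; right; rewrite ltrD2l; lra.
by have := ub_le_sup (proj2 Esup) Ey; rewrite leNgt cy.
Qed.

Section Derivative.
Context (R : realType) (V : frechetType R).
Implicit Types (f g : R -> V) (t : R).

Definition has_derive f t (l : V) :=
  h^-1 *: (f (h + t) - f t) @[h --> (0 : R)^'] --> l.

Lemma path_derivableP f t :
  path_derivable f t -> has_derive f t (path_derive f t).
Proof. by move=> [l fl]; rewrite (path_derive_eq fl). Qed.

(** Local convexity, with the weights of a convex combination as two plain reals,
as they arise when an interval is cut in two. *)
Lemma convex_nbhs0 (N : set V) : nbhs 0 N ->
  exists W : set V, [/\ nbhs 0 W, W `<=` N &
    forall (a b : R) x y, 0 <= a -> 0 <= b -> a + b = 1 -> W x -> W y ->
      W (a *: x + b *: y)].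
Proof.
move=> N0; have [B Bconv [Bopen Bbase]] := @locally_convex R V.
have [W [BW W0] WN] := Bbase 0 N N0.
exists W; split=> //; first by apply: open_nbhs_nbhs; split=> //; exact: Bopen.
move=> a b x y a0 b0 ab Wx Wy.
have a1 : a <= 1 by rewrite -ab lerDl.
have -> : b = 1 - a by rewrite -ab addrC addKr.
apply: set_mem.
exact: (Bconv W (mem_set BW) x y (Itv01 a0 a1) (mem_set Wx) (mem_set Wy)).
Qed.

Lemma eq0_of_nbhs (x : V) : (forall N, nbhs 0 N -> N x) -> x = 0.
Proof.
move=> x0; apply: (@frechet_hausdorff R V) => A B Ax B0.
by exists x; split; [exact: nbhs_singleton | exact: x0].
Qed.

(** For a convex neighbourhood W of 0, let Q x y say that f y - f x lies in the
dilate of W by y - x.  Convexity makes Q additive, the vanishing of the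
derivative makes it hold on both sides of any point, so it holds for all
intervals; the slope of f between a and b is then in every W, and is 0. *)
Lemma has_derive0_eq f : (forall t, has_derive f t 0) -> forall a b, f a = f b.
Proof.
move=> f0 a b; wlog ab : a b / a < b.
  move=> H; have [|/H//|<-//] := ltgtP a b; by move=> /H.
suff : (b - a)^-1 *: (f b - f a) = 0.
  move=> /(congr1 ( *:%R (b - a))); rewrite scaler0 scalerA divff ?scale1r.
    by move=> /eqP; rewrite subr_eq0 => /eqP.
  by rewrite subr_eq0 gt_eqF.
apply: eq0_of_nbhs => N /convex_nbhs0[W [W0 WN Wconv]].
pose Q x y := exists2 w, W w & f y - f x = (y - x) *: w.
suff [w Ww ->] : Q a b.
  by rewrite scalerA mulVf ?scale1r ?subr_eq0 ?gt_eqF//; exact: WN.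
have Qadd x y z : x <= y -> y <= z -> Q x y -> Q y z -> Q x z.
  move=> xy yz [u Wu fu] [v Wv fv].
  have [xz|xz] := eqVneq x z.
    by exists u => //; rewrite -xz !subrr scale0r.
  have zx : 0 < z - x by rewrite subr_gt0 lt_neqAle xz (le_trans xy).
  (* The slope over [x, z] is the mean of the slopes u and v, weighted by length. *)
  exists (((y - x) / (z - x)) *: u + ((z - y) / (z - x)) *: v).
    by apply: Wconv => //; [apply: divr_ge0; lra | apply: divr_ge0; lra |
      field; lra].
  have -> : f z - f x = (f y - f x) + (f z - f y) by rewrite [RHS]addrC subrKA.
  rewrite fu fv scalerDr !scalerA.
  by congr (_ *: _ + _ *: _); field; lra.
apply: (local_to_global_additive Qadd); last exact: ltW.
move=> s; have := f0 s W W0; rewrite /nbhs /= /nbhs /= => -[d d0 dW].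
have loc h : `|h| < d -> exists2 w, W w & f (h + s) - f s = h *: w.
  move=> hd; have [->|h0] := eqVneq h 0.
    by exists 0; [exact: nbhs_singleton | rewrite add0r subrr scale0r].
  exists (h^-1 *: (f (h + s) - f s)); last by rewrite scalerA divff ?scale1r.
  by apply: dW => //=; rewrite sub0r normrN.
exists d => // x y sx xs sy ys.
apply: (Qadd _ s) => //.
  have [|w Ww] := loc (x - s); first by rewrite ler0_norm; lra.
  by rewrite subrK => e; exists w => //; rewrite -opprB e -scaleNr opprB.
have [|w Ww] := loc (y - s); first by rewrite ger0_norm; lra.
by rewrite subrK => e; exists w.
Qed.

End Derivative.

(** * Rules of differentiation *)

Section DerivativeRules.
Context (R : realType) (V : frechetType R).
Implicit Types (f g : R -> V) (t : R).

Lemma frechet_cvgD (T : Type) (F : set_system T) {FF : Filter F}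
    (f g : T -> V) (a b : V) :
  f @ F --> a -> g @ F --> b -> (f x + g x) @[x --> F] --> a + b.
Proof.
move=> fa gb.
apply: (@continuous2_cvg _ V V V F FF f g (fun x y => x + y) a b) fa gb.
exact: (@add_continuous V (a, b)).
Qed.

Lemma frechet_cvgN (T : Type) (F : set_system T) {FF : Filter F}
    (f : T -> V) (a : V) :
  f @ F --> a -> (- f x) @[x --> F] --> - a.
Proof. by move=> fa; apply: continuous_cvg fa; exact: opp_continuous. Qed.

Lemma frechet_cvgZ (T : Type) (F : set_system T) {FF : Filter F}
    (g : T -> R) (f : T -> V) (k : R) (a : V) :
  g @ F --> k -> f @ F --> a -> (g x *: f x) @[x --> F] --> k *: a.
Proof.
move=> gk fa.
apply: (@continuous2_cvg _ R^o V V F FF g f (fun x y => x *: y) k a) gk fa.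
exact: (@scale_continuous R V (k, a)).
Qed.

Lemma frechet_cvg_sum (T I : Type) (F : set_system T) {FF : Filter F} (r : seq I)
    (f : I -> T -> V) (a : I -> V) :
  (forall i, f i @ F --> a i) ->
  (\sum_(i <- r) f i x) @[x --> F] --> \sum_(i <- r) a i.
Proof. by move=> fa; apply: cvg_big => //; exact: add_continuous. Qed.

Lemma has_derive_cst (a : V) t : has_derive (fun=> a) t 0.
Proof.
rewrite /has_derive; under eq_fun do rewrite subrr scaler0.
exact: cvg_cst.
Qed.

Lemma has_deriveD f g t l m : has_derive f t l -> has_derive g t m ->
  has_derive (fun s => f s + g s) t (l + m).
Proof.
move=> fl gm; rewrite /has_derive.
under eq_fun do rewrite opprD addrACA scalerDr.
exact: frechet_cvgD.
Qed.

Lemma has_deriveN f t l : has_derive f t l -> has_derive (fun s => - f s) t (- l).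
Proof.
move=> fl; rewrite /has_derive.
under eq_fun do rewrite -opprD scalerN.
exact: frechet_cvgN.
Qed.

Lemma has_derive_sum (I : Type) (r : seq I) (f : I -> R -> V) t (l : I -> V) :
  (forall i, has_derive (f i) t (l i)) ->
  has_derive (fun s => \sum_(i <- r) f i s) t (\sum_(i <- r) l i).
Proof.
move=> fl; rewrite /has_derive.
under eq_fun do rewrite -sumrB scaler_sumr.
exact: frechet_cvg_sum.
Qed.

Lemma has_derive_continuous f t l : has_derive f t l ->
  f (h + t) @[h --> (0 : R)^'] --> f t.
Proof.
move=> fl.
have h0 : id @ (0 : R)^' --> (0 : R) by move=> ? ?; exact: nbhs_dnbhs.
have E : {near (0 : R)^', (fun h => h *: (h^-1 *: (f (h + t) - f t)) + f t) =1
    (fun h => f (h + t))}.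
  near=> h; rewrite scalerA divff ?scale1r ?subrK//.
  by near: h; exact: nbhs_dnbhs_neq.
apply: cvg_trans (near_eq_cvg E) _.
have := frechet_cvgD (frechet_cvgZ h0 fl) (cvg_cst (f t)).
by rewrite scale0r add0r; apply.
Unshelve. all: by end_near. Qed.

End DerivativeRules.

Section DerivativeAlgebra.
Context (R : realType) (A : frechetAlgType R).
Implicit Types (f g : R -> A) (t : R).

Lemma frechet_cvgM (T : Type) (F : set_system T) {FF : Filter F}
    (f g : T -> A) (a b : A) :
  f @ F --> a -> g @ F --> b -> (f x * g x) @[x --> F] --> a * b.
Proof.
move=> fa gb.
apply: (@continuous2_cvg _ A A A F FF f g (fun x y => x * y) a b) fa gb.
exact: (@frechet_mul_continuous R A (a, b)).
Qed.

Lemma has_deriveM f g t l m : has_derive f t l -> has_derive g t m ->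
  has_derive (fun s => f s * g s) t (l * g t + f t * m).
Proof.
move=> fl gm; rewrite /has_derive.
rewrite [X in X @ _ --> _](_ : _ = (fun h : R =>
    (h^-1 *: (f (h + t) - f t)) * g (h + t)
    + f t * (h^-1 *: (g (h + t) - g t)))); last first.
  apply/funext => h; rewrite -scalerAl -scalerAr -scalerDr.
  by rewrite mulrBl mulrBr subrKA.
apply: frechet_cvgD; apply: frechet_cvgM => //; last exact: cvg_cst.
exact: has_derive_continuous gm.
Qed.

(** The scalars t%:A are central, so evaluation at them obeys the usual rules even
though the coefficients of p need not commute. *)
Lemma has_derive_horner (p : {poly A}) t :
  has_derive (fun s => p.[s%:A]) t p^`().[t%:A].
Proof.
elim/poly_ind: p => [|p c IH].
  rewrite (_ : (fun s => _) = (fun=> 0)); last first.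
    by apply/funext => s; rewrite horner0.
  by rewrite deriv0 horner0; exact: has_derive_cst.
rewrite (_ : (fun s => _) = (fun s : R => p.[s%:A] * s%:A + c)); last first.
  by apply/funext => s; rewrite hornerMXaddC.
rewrite derivMXaddC hornerD hornerMX addrC -[X in has_derive _ _ X]addr0.
apply: has_deriveD; last exact: has_derive_cst.
rewrite -[X in _ + X]mulr1; apply: has_deriveM => //.
rewrite /has_derive -[X in _ --> X]scale1r.
by apply: path_derive_scale; exact: is_derive_id.
Qed.

End DerivativeAlgebra.

(** * Riemann integrals of polynomial paths *)

Section TaggedPartitions.
Context (R : realType).
Implicit Types (a b d x : R) (p : seq R * seq R).

Lemma tagged_partition_cons a b d x p : a < x -> x - a < d ->
  tagged_partition x b d p -> tagged_partition a b d (x :: p.1, x :: p.2).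
Proof.
move=> ax xad [[xp /eqP pb] sp tp]; split=> /=.
- by split; rewrite /= ?ax ?pb.
- by rewrite sp.
- by case=> [_|i ip] /=; [rewrite (ltW ax) lexx | exact: tp].
Qed.

Lemma tagged_partition_exists a b d : a <= b -> 0 < d ->
  tagged_partition a b d !=set0.
Proof.
move=> ab d0.
have nil x : tagged_partition x x d ([::], [::]) by split.
have d20 : 0 < d / 2 by exact: divr_gt0.
suff H n : forall x, x <= b -> b - x < n%:R * (d / 2) ->
    tagged_partition x b d !=set0.
  apply: (H (Num.bound ((b - a) / (d / 2))) a ab).
  rewrite -ltr_pdivrMr//; apply: archi_boundP.
  by apply: divr_ge0; [rewrite subr_ge0 | exact: ltW].
elim: n => [|n IH] x xb; first by rewrite mul0r subr_lt0 ltNge xb.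
rewrite -natr1 mulrDl mul1r => xn.
have [bx|xdb] := leP b (x + d / 2).
  have [xeb|xltb] := eqVneq x b; first by exists ([::], [::]); rewrite xeb.
  exists ([:: b], [:: b]); apply: tagged_partition_cons (nil b).
    by rewrite lt_neqAle xltb.
  by lra.
have [||p hp] := IH (x + d / 2); [exact: ltW|lra|].
by eexists; apply: tagged_partition_cons hp; lra.
Qed.

#[global] Instance riemann_filter_filter a b : Filter (riemann_filter a b).
Proof.
apply: filter_from_filter; first by exists 1 => /=.
move=> d e /= d0 e0; exists (Num.min d e); first by rewrite /= lt_min d0.
move=> p [ab sp tp]; split; split=> // i /tp[? ]; rewrite lt_min => /andP[? ?];
  by split.
Qed.

Lemma riemann_filter_proper a b : a <= b -> ProperFilter (riemann_filter a b).
Proof.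
by move=> ab; apply: filter_from_proper => d d0; exact: tagged_partition_exists.
Qed.

(** The mean value theorem writes each increment of F as the length of the
subinterval times a value of f within distance d of the tag. *)
Lemma riemann_sum_error (f F : R -> R) a b d C p :
  (forall x, is_derive x 1 F (f x)) -> 0 <= C ->
  (forall x y, a <= x <= b -> a <= y <= b -> `|f x - f y| <= C * `|x - y|) ->
  tagged_partition a b d p ->
  `|F b - F a - \sum_(i < size p.1)
      (nth 0 p.1 i - nth 0 (a :: p.1) i) * f (nth 0 p.2 i)|
    <= C * d * (b - a).
Proof.
move=> dF C0 lipf [abp sp tp]; set n := size p.1.
pose u i := nth b (a :: p.1) i.
have uE i : (i <= n)%N -> nth 0 (a :: p.1) i = u i.
  by move=> ni; apply: set_nth_default.
have uSE i : (i < n)%N -> nth 0 p.1 i = u i.+1.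
  by move=> ni; rewrite -uE.
have un : u n = b by exact: itv_partition_nth_size.
have tele (G : R -> R) : G b - G a = \sum_(i < n) (G (u i.+1) - G (u i)).
  rewrite -(big_mkord predT (fun i => G (u i.+1) - G (u i))).
  by rewrite (telescope_sumr (fun i => G (u i))) // un.
rewrite (tele F) (tele id) -sumrB mulr_sumr.
apply: le_trans (ler_norm_sum _ _ _) _; apply: ler_sum => i _.
have ni := ltn_ord i; have [/= + +] := tp i ni.
rewrite uE ?(ltnW ni)// uSE// => /andP[] ut tu ud.
have au : a <= u i by apply: itv_partition_nth_ge abp; rewrite ltnS ltnW.
have ub : u i.+1 <= b by apply: itv_partition_nth_le abp.
have [||c] := @MVT_segment R F f (u i) (u i.+1).
- exact: le_trans ut tu.
- by apply: derivable_within_continuous => x _; have [] := dF x.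
rewrite in_itv /= => /andP[uc cu] ->.
have uu : 0 <= u i.+1 - u i by rewrite subr_ge0 (le_trans uc).
rewrite [f c * _]mulrC -mulrBr normrM mulrC (ger0_norm uu) ler_wpM2r//.
apply: le_trans (lipf _ _ _ _) _; first by apply/andP; split; lra.
  by apply/andP; split; lra.
by apply: ler_wpM2l => //; rewrite ler_norml; apply/andP; split; lra.
Qed.

Lemma riemann_sum_cvg (f F : R -> R) a b C :
  (forall x, is_derive x 1 F (f x)) -> 0 <= C -> a <= b ->
  (forall x y, a <= x <= b -> a <= y <= b -> `|f x - f y| <= C * `|x - y|) ->
  (fun p => \sum_(i < size p.1)
      (nth 0 p.1 i - nth 0 (a :: p.1) i) * f (nth 0 p.2 i))
    @ riemann_filter a b --> F b - F a.
Proof.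
move=> dF C0 ab lipf; apply/cvgrPdist_le => e e0.
have K0 : 0 < C * (b - a) + 1 by rewrite ltr_wpDl ?mulr_ge0 ?subr_ge0.
exists (e / (C * (b - a) + 1)) => /=; first exact: divr_gt0.
move=> p hp /=; apply: le_trans (riemann_sum_error dF C0 lipf hp) _.
rewrite [C * _]mulrC -mulrA mulrAC ler_pdivrMr// ler_wpM2l ?ltW//.
by rewrite ltrDl.
Qed.

Lemma lipschitz_exp m (B : R) : exists2 C, 0 <= C &
  forall x y, `|x| <= B -> `|y| <= B -> `|x ^+ m - y ^+ m| <= C * `|x - y|.
Proof.
have [B0|B0] := leP 0 B; last first.
  by exists 0 => // x y xB; have := le_lt_trans xB B0; rewrite normr_lt0.
elim: m => [|m [C C0 HC]].
  by exists 0 => // x y _ _; rewrite !expr0 subrr normr0 mul0r.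
exists (B * C + B ^+ m); first by rewrite addr_ge0 ?mulr_ge0 ?exprn_ge0.
move=> x y xB yB.
have -> : x ^+ m.+1 - y ^+ m.+1 = x * (x ^+ m - y ^+ m) + y ^+ m * (x - y).
  by rewrite !exprS; ring.
rewrite (le_trans (ler_normD _ _))// mulrDl !normrM lerD//.
  by rewrite -mulrA ler_pM ?HC.
by rewrite ler_wpM2r// normrX lerXn2r ?nnegrE.
Qed.

(** The integrand is the derivative of the m-th power, rather than a plain
monomial: it is what the derivative of a polynomial produces term by term, and it
needs no division. *)
Lemma riemann_sum_cvg_exp m a b : a <= b ->
  (fun p => \sum_(i < size p.1)
      (nth 0 p.1 i - nth 0 (a :: p.1) i) * (m%:R * nth 0 p.2 i ^+ m.-1))
    @ riemann_filter a b --> b ^+ m - a ^+ m.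
Proof.
move=> ab; have [C C0 HC] := lipschitz_exp m.-1 (`|a| + `|b|).
rewrite -[b ^+ m]mul1r -[a ^+ m]mul1r.
apply: (@riemann_sum_cvg (fun x => m%:R * x ^+ m.-1) (fun x => 1 * x ^+ m) a b
  (m%:R * C)) => //; last 2 first.
- by rewrite mulr_ge0.
- have bnd x : a <= x <= b -> `|x| <= `|a| + `|b|.
    move=> /andP[ax xb]; have := ler_norm b; have := ler_norm (- a).
    have := normr_ge0 a; have := normr_ge0 b; rewrite normrN => *.
    by rewrite ler_norml; apply/andP; split; lra.
  move=> x y /bnd hx /bnd hy; rewrite -mulrBr normrM ger0_norm//.
  by rewrite -mulrA ler_wpM2l ?HC.
by move=> x; have := is_derive_monomial 1 x m; rewrite mul1r.
Qed.

End TaggedPartitions.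

Lemma limit_eq (V : PreTopologicalZmodule.type) (F : set_system V) (l : V) :
  hausdorff_space V -> ProperFilter F -> F --> l -> limit F = l.
Proof.
move=> Vh FF Fl; rewrite /limit; case: xgetP => [m _ Fm|/(_ l)//].
exact: (cvg_unique Vh Fm Fl).
Qed.

Section PolynomialPaths.
Context (R : realType) (A : frechetAlgType R).
Implicit Types (p Q : {poly A}) (a b t : R).

Lemma horner_scalar Q t : Q.[t%:A] = \sum_(i < size Q) t ^+ i *: Q`_i.
Proof.
rewrite horner_coef; apply: eq_bigr => i _.
by rewrite exprZn expr1n mulr_algr.
Qed.

Lemma horner_deriv_scalar Q t :
  Q^`().[t%:A] = \sum_(i < size Q) (i%:R * t ^+ i.-1) *: Q`_i.
Proof.
rewrite -{1}(coefK Q) poly_def raddf_sum horner_sum; apply: eq_bigr => i _.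
rewrite /= derivZ derivXn hornerZ hornerMn hornerXn exprZn expr1n mulrnAr.
by rewrite mulr_algr -scaler_nat scalerA.
Qed.

(** Riemann sums of a scalar function times a fixed vector are scalar Riemann sums,
so the convergence in A follows from that in R, monomial by monomial. *)
Lemma riemann_sum_horner Q a b : a <= b ->
  riemann_sum (fun s => Q^`().[s%:A]) a @ riemann_filter a b
    --> Q.[b%:A] - Q.[a%:A].
Proof.
move=> ab; rewrite !horner_scalar -sumrB.
rewrite (_ : riemann_sum _ a = fun x => \sum_(j < size Q)
    (\sum_(i < size x.1) (nth 0 x.1 i - nth 0 (a :: x.1) i) *
      (j%:R * nth 0 x.2 i ^+ j.-1)) *: Q`_j); last first.
  apply/funext => x; rewrite /riemann_sum.
  under eq_bigr do rewrite horner_deriv_scalar scaler_sumr.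
  rewrite exchange_big; apply: eq_bigr => j _; rewrite scaler_suml.
  by apply: eq_bigr => i _; rewrite scalerA.
apply: frechet_cvg_sum => j; rewrite -scalerBl.
by apply: frechet_cvgZ; [exact: riemann_sum_cvg_exp | exact: cvg_cst].
Qed.

Lemma path_integral_deriv_horner Q a b :
  path_integral (fun s => Q^`().[s%:A]) a b = Q.[b%:A] - Q.[a%:A].
Proof.
have I x y : x <= y -> limit (riemann_sum (fun s => Q^`().[s%:A]) x
    @ riemann_filter x y) = Q.[y%:A] - Q.[x%:A].
  move=> xy; apply: limit_eq; first exact: (@frechet_hausdorff R A).
    by apply: fmap_proper_filter; exact: riemann_filter_proper.
  exact: riemann_sum_horner.
rewrite /path_integral; have [ab|ba] := leP a b; first exact: I.
by rewrite I ?ltW// opprB.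
Qed.

Lemma poly_antiderivative p : exists2 Q, Q^`() = p & Q.[0] = 0.
Proof.
exists (\poly_(i < (size p).+1) ((i%:R : R)^-1 *: p`_i.-1)); last first.
  (* The constant term is 0 because the inverse of 0 is 0. *)
  by rewrite horner_coef0 coef_poly /= invr0 scale0r.
apply/polyP => i; rewrite coef_deriv coef_poly ltnS; case: ltnP => ip.
  by rewrite -scaler_nat scalerA divff ?scale1r// pnatr_eq0.
by rewrite mul0rn nth_default.
Qed.

End PolynomialPaths.

(** * Differential equations for paths of formal power series *)

Section FpsPaths.
Context (R : realType) (A : frechetAlgType R).
Implicit Types (v f g : R -> fps A) (t : R) (l m : fps A).

Lemma fps_coefM (x y : fps A) k :
  (x * y) k = \sum_(j < k.+1) x j * y (k - j)%N.
Proof. by []. Qed.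

Lemma fps_coef_sum (I : Type) (r : seq I) (x : I -> fps A) k :
  (\sum_(i <- r) x i) k = \sum_(i <- r) x i k.
Proof. by elim: r => [|i r IH]; rewrite ?big_nil// !big_cons -IH. Qed.

Definition fps_has_derive f t l := forall k, has_derive (fun s => f s k) t (l k).

Lemma fps_has_derive_cst l t : fps_has_derive (fun=> l) t 0.
Proof. by move=> k; exact: has_derive_cst. Qed.

Lemma fps_has_deriveB f g t l m : fps_has_derive f t l ->
  fps_has_derive g t m -> fps_has_derive (fun s => f s - g s) t (l - m).
Proof. by move=> fl gm k; apply: has_deriveD => //; exact: has_deriveN. Qed.

Lemma fps_has_derive_sum (I : Type) (r : seq I) (f : I -> R -> fps A) t
    (l : I -> fps A) : (forall i, fps_has_derive (f i) t (l i)) ->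
  fps_has_derive (fun s => \sum_(i <- r) f i s) t (\sum_(i <- r) l i).
Proof.
move=> fl k; rewrite fps_coef_sum.
rewrite (_ : (fun s => _) = (fun s => \sum_(i <- r) f i s k)).
  by apply: has_derive_sum => i; exact: fl.
by apply/funext => s; rewrite fps_coef_sum.
Qed.

Lemma fps_has_deriveM f g t l m : fps_has_derive f t l ->
  fps_has_derive g t m ->
  fps_has_derive (fun s => f s * g s) t (l * g t + f t * m).
Proof.
move=> fl gm k; rewrite [X in has_derive _ _ X](_ : _ = \sum_(j < k.+1)
    (l j * g t (k - j)%N + f t j * m (k - j)%N)); last by rewrite big_split.
by apply: has_derive_sum => j; exact: has_deriveM.
Qed.

Lemma fps_antiderivative_unique f g (d : R -> fps A) :
  (forall t, fps_has_derive f t (d t)) -> (forall t, fps_has_derive g t (d t)) ->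
  f 0 = g 0 -> f =1 g.
Proof.
move=> fd gd fg0 t; apply/subr0_eq/funext => k.
transitivity ((f 0 - g 0) k); last by rewrite fg0 subrr.
apply: (@has_derive0_eq R A (fun s => (f s - g s) k)) => s.
by rewrite -(subrr (d s k)); exact: fps_has_deriveB.
Qed.

(** Since v has positive valuation, the coefficient of v f in degree k only sees the
coefficients of f in lower degrees, so these vanish one after the other. *)
Lemma fps_linear_ode_eq0 v f : (forall t, fps_gt0 (v t)) ->
  (forall t, fps_has_derive f t (v t * f t)) -> f 0 = 0 -> forall t, f t = 0.
Proof.
move=> v0 df f0 t; apply/funext => k; elim/ltn_ind: k t => k IH t.
transitivity (f 0 k); last by rewrite f0.
apply: (@has_derive0_eq R A (fun s => f s k)) => s.
suff <- : (v s * f s) k = 0 by exact: df.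
rewrite fps_coefM big1// => -[[|j] jk] _ /=; first by rewrite v0 mul0r.
by rewrite IH ?mulr0// ltn_subrL /= (leq_ltn_trans (leq0n j) jk).
Qed.

(** The degree in t of the k-th coefficient may grow with k. *)
Definition poly_path f := forall k, exists p : {poly A}, forall t,
  f t k = p.[t%:A].

Lemma poly_path_cst l : poly_path (fun=> l).
Proof. by move=> k; exists (l k)%:P => t; rewrite hornerC. Qed.

Lemma poly_pathM f g : poly_path f -> poly_path g ->
  poly_path (fun t => f t * g t).
Proof.
move=> /choice[p fp] /choice[q gq] k.
exists (\sum_(j < k.+1) p j * q (k - j)%N) => t.
rewrite fps_coefM horner_sum; apply: eq_bigr => j _; rewrite fp gq.
by rewrite hornerM_comm// /comm_poly mulr_algl mulr_algr.
Qed.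

Lemma fps_path_integral_poly f : poly_path f ->
  [/\ poly_path (fps_path_integral f 0),
      forall t, fps_has_derive (fps_path_integral f 0) t (f t) &
      fps_path_integral f 0 0 = 0].
Proof.
move=> fpoly.
have {fpoly}/choice[Q HQ] k : exists Q : {poly A}, [/\ Q.[0] = 0,
    (forall t, f t k = Q^`().[t%:A]) &
    forall t, fps_path_integral f 0 t k = Q.[t%:A]].
  have [p fp] := fpoly k; have [Q Qp Q0] := poly_antiderivative p.
  exists Q; split=> // t; first by rewrite Qp.
  rewrite /fps_path_integral (_ : (fun s => _) = (fun s => Q^`().[s%:A])).
    by rewrite path_integral_deriv_horner scale0r Q0 subr0.
  by apply/funext => s; rewrite Qp.
split=> [k|t k|].
- by exists (Q k); have [] := HQ k.
- have [_ fQ IQ] := HQ k.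
  rewrite fQ (_ : (fun s => _) = (fun s => (Q k).[s%:A])).
    exact: has_derive_horner.
  exact/funext.
- by apply/funext => k; have [Q0 _ ->] := HQ k; rewrite scale0r Q0.
Qed.

(** A subbasic neighbourhood in the product topology constrains one coefficient
only, so the rank N may depend on k. *)
Lemma fps_cvg_eventually (s : nat -> fps A) (l : fps A) :
  (forall k, exists N, forall n, (N <= n)%N -> s n k = l k) -> s @ \oo --> l.
Proof.
move=> sl; apply/cvg_sup => k U [B [[W] oW <-] Wl WU].
have [N sN] := sl k; apply: (filterS WU); exists N => // n /= Nn.
by rewrite /proj /= sN.
Qed.

End FpsPaths.

(** * The group exponential *)

Section GroupExponential.
Context (R : realType) (A : frechetAlgType R) (v : R -> fps A).
Hypotheses (v_poly : poly_path v) (v_gt0 : forall t, fps_gt0 (v t)).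
Implicit Types (t : R) (w : fps A).

Let E i := iterated_integral v i 1.
Let S n t := \sum_(i < n) E i t.
Let U := group_exp v.

Lemma iterated_integralS i :
  E i.+1 = fps_path_integral (fun s => iterated_integral v i (v s) s) 0.
Proof. by rewrite /E; apply/funext => t /=; under eq_fun do rewrite mul1r. Qed.

(** The induction is on all starting values w at once: the definition changes w at
each step, and the second clause turns it into a left factor.  A constant left
factor comes out of an integral because both sides have the same derivative and
vanish at 0. *)
Lemma iterated_integralE i : [/\ poly_path (E i),
  forall w t, iterated_integral v i w t = w * E i t &
  E i.+1 = fps_path_integral (fun s => v s * E i s) 0].
Proof.
elim: i => [|i [Ei_poly iterE Eint]].
  split; [exact: poly_path_cst | by move=> w t; rewrite mulr1 |].
  rewrite iterated_integralS; congr fps_path_integral.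
  by apply/funext => s; rewrite mulr1.
have [I_poly dI I0] := fps_path_integral_poly (poly_pathM v_poly Ei_poly).
rewrite -Eint in I_poly dI I0.
have iterSE w t : iterated_integral v i.+1 w t = w * E i.+1 t.
  rewrite /= (_ : (fun s => _) = (fun s => w * (v s * E i s))); last first.
    by apply/funext => s; rewrite iterE mulrA.
  have wpoly := poly_pathM (poly_path_cst w) (poly_pathM v_poly Ei_poly).
  have [_ dJ J0] := fps_path_integral_poly wpoly.
  apply: (fps_antiderivative_unique (g := fun t => w * E i.+1 t) dJ) => [s|];
    last by rewrite J0 I0 mulr0.
  rewrite -[w * (_ * _)]add0r -[X in X + _](mul0r (E i.+1 s)).
  by apply: fps_has_deriveM => //; exact: fps_has_derive_cst.
split=> //; rewrite iterated_integralS; congr fps_path_integral.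
by apply/funext => s; rewrite iterSE.
Qed.

Lemma has_derive_iterated i t : fps_has_derive (E i.+1) t (v t * E i t).
Proof.
have [Ep _ ->] := iterated_integralE i.
have [_ dI _] := fps_path_integral_poly (poly_pathM v_poly Ep); exact: dI.
Qed.

Lemma iterated_integral0 i : E i.+1 0 = 0.
Proof.
have [Ep _ ->] := iterated_integralE i.
by have [] := fps_path_integral_poly (poly_pathM v_poly Ep).
Qed.

Lemma iterated_integral_valuation i k t : (k < i)%N -> E i t k = 0.
Proof.
elim: i k t => // i IH k t ki.
rewrite -[RHS](congr1 (fun x : fps A => x k) (iterated_integral0 i)).
apply: (@has_derive0_eq R A (fun s => E i.+1 s k)) => s.
suff <- : (v s * E i s) k = 0 by exact: has_derive_iterated.
rewrite fps_coefM big1// => -[[|j] jk] _ /=; first by rewrite v_gt0 mul0r.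
by rewrite IH ?mulr0// (@leq_trans k)// ltn_subrL /= (leq_ltn_trans (leq0n j) jk).
Qed.

Lemma partial_sum_coef n m t k : (k < n)%N -> (k < m)%N -> S n t k = S m t k.
Proof.
wlog nm : n m / (n <= m)%N => [H|kn _].
  by have [/H//|/ltnW/H H' kn km] := leqP n m; rewrite H'.
rewrite /S -(subnKC nm) big_split_ord /= [RHS](_ : _ =
  (\sum_(i < n) E i t) k + (\sum_(i < m - n) E (n + i)%N t) k)//.
rewrite [X in _ + X]fps_coef_sum [X in _ + X]big1 ?addr0// => i _.
by rewrite iterated_integral_valuation// ltn_addr.
Qed.

Lemma group_exp_coef n t k : (k < n)%N -> U t k = S n t k.
Proof.
move=> kn; suff -> : U t = (fun k => S k.+1 t k) by exact: partial_sum_coef.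
apply: limit_eq.
- by apply: hausdorff_product => j; exact: (@frechet_hausdorff R A).
- apply: fps_cvg_eventually => j; exists j.+1 => N jN.
  by rewrite /series /= big_mkord; exact: partial_sum_coef.
Qed.

Lemma group_exp_in_group t : fps_group (U t).
Proof.
exists (U t - 1); last by rewrite addrC subrK.
rewrite /fps_gt0 /= [LHS](_ : _ = U t 0%N - 1)//.
by rewrite (@group_exp_coef 1)// /S big_ord1 subrr.
Qed.

Lemma group_exp0 : U 0 = 1.
Proof.
apply/funext => k; rewrite (@group_exp_coef k.+1)// /S big_ord_recl big1 ?addr0//.
by move=> i _; exact: iterated_integral0.
Qed.

(** In degree k the derivative of the sum of E_0, ..., E_k is v times the sum of
E_0, ..., E_(k-1).  The latter agrees with U in degrees less than k only, which
is enough because v has no constant term. *)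
Lemma has_derive_group_exp t : fps_has_derive U t (v t * U t).
Proof.
move=> k; have -> : (v t * U t) k = (v t * S k t) k.
  rewrite !fps_coefM; apply: eq_bigr => -[[|j] jk] _ /=.
    by rewrite v_gt0 !mul0r.
  by rewrite (@group_exp_coef k)// ltn_subrL /= (leq_ltn_trans (leq0n j) jk).
rewrite (_ : (fun s => _) = (fun s => S k.+1 s k)); last first.
  by apply/funext => s; exact: group_exp_coef.
rewrite -[v t * _]add0r mulr_sumr.
suff : fps_has_derive (S k.+1) t (0 + \sum_(i < k) v t * E i t) by apply.
rewrite (_ : S k.+1 = (fun s => \sum_(i < k.+1) E i s))//.
rewrite (_ : 0 + _ = \sum_(i < k.+1)
    (if nat_of_ord i is j.+1 then v t * E j t else 0)); last first.
  by rewrite [RHS]big_ord_recl.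
apply: fps_has_derive_sum => -[[|j] jk] /=; first exact: fps_has_derive_cst.
exact: has_derive_iterated.
Qed.

(** The path L U - U L0 solves the linear equation f' = v f with f(0) = 0. *)
Lemma lax_solution_conjugate (L : R -> fps A) (L0 : fps A) :
  (forall t, fps_has_derive L t (v t * L t - L t * v t)) -> L 0 = L0 ->
  forall t, L t = U t * L0 * (U t)^-1.
Proof.
move=> dL LE t; apply: (canRL (mulrK (fps_group_unit (group_exp_in_group t)))).
apply/subr0_eq; move: t; apply: (fps_linear_ode_eq0 v_gt0) => [t|]; last first.
  by rewrite LE group_exp0 mulr1 mul1r subrr.
have dU := @has_derive_group_exp t.
have := fps_has_deriveB (fps_has_deriveM (dL t) dU)
  (fps_has_deriveM dU (fps_has_derive_cst L0 t)).
by rewrite mulr0 addr0 mulrBl !mulrA subrK mulrBr !mulrA.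
Qed.

End GroupExponential.

(** * Solutions of the scaled Lax equation *)

Lemma scaled_path_poly (R : realType) (A : frechetAlgType R) (P : R -> A) :
  poly_path (scaled_path P).
Proof.
case=> [|k] /=; first by exists 0 => t; rewrite horner0.
exists (((k`!%:R : R)^-1 *: path_deriven k P 0) *: 'X^k) => t.
by rewrite hornerZ hornerXn exprZn expr1n mulr_algr scalerA.
Qed.

Theorem theorem3p1 (R : realType) (A : frechetAlgType R) (P : R -> A) (L0 : A)
    (L : R -> fps A) :
  smooth_path P ->
  (forall t, fps_path_derivable L t) ->
  (forall t, fps_path_derive L t =
    scaled_path P t * L t - L t * scaled_path P t) ->
  L 0 = fps_const L0 ->
  forall t, fps_group (group_exp (scaled_path P) t) /\
    L t = group_exp (scaled_path P) t * fps_const L0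
          * (group_exp (scaled_path P) t)^-1.
Proof.
move=> _ dL LE L0E t.
have v_poly := scaled_path_poly P; have v_gt0 := scaled_path_gt0 P.
split; first exact: group_exp_in_group.
apply: lax_solution_conjugate => // s k; rewrite -LE.
exact: (path_derivableP (dL s k)).
Qed.
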